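(* Let $q\in\mathbb{C}$ with $|q|<1$ and let $r,k$ be natural numbers. Then $$\sum_{n=1}^\infty \frac{(-1)^{n-1}q^{\binom{n}{2}+nr}}{(1-q^n)^k(q)_n} = \sum_{t=1}^k \sum_{j=0}^{k-t} \binom{k-1}{j+t-1} A(j+t,r,t)\, U_{t,r+j+t-1}(q) + \sum_{j=1}^k \binom{k-1}{j-1} A(j,r,0)\, U_{0,r+j-1} (q),$$ where $$A(j,r,t)=\sum_{l=t}^j \frac{s(j,l)}{j!}\binom{l}{t} (1-r)^{l-t},\qquad U_{m,i}(q)=\sum_{n=i}^\infty n^m q^n(q^{n+1})_\infty .$$
   Context: For $x\in\mathbb{C}$: $(x)_n=(1-x)(1-xq)\cdots(1-xq^{n-1})$ ($(x)_0=1$), $(x)_\infty=\lim_{n\to\infty}(x)_n$. $s(j,l)$ denotes the (signed) Stirling numbers of the first kind, defined by $x(x-1)\cdots(x-j+1)=\sum_{l=0}^j s(j,l)x^l$. *)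

(* Defs.v *)
From HB Require Import structures.
From mathcomp Require Import all_boot all_order all_algebra.
From mathcomp Require Import all_classical all_reals all_analysis.
From mathcomp Require Import complex.

Set Implicit Arguments.
Unset Strict Implicit.
Unset Printing Implicit Defensive.

Import Order.TTheory GRing.Theory Num.Theory.
Import numFieldNormedType.Exports.

Local Open Scope classical_set_scope.
Local Open Scope ring_scope.

(* Packing R[i] as a numClosedFieldType gives it the norm topology that
   MathComp-Analysis puts on every such structure; on the bare type R[i] that
   topology is not inferred. *)
Definition Cplx (R : realType) : numClosedFieldType := R[i].

(* (x)_n for the base q; the base comes first. *)
Definition qpoch (K : numFieldType) (q x : K) (n : nat) : K :=
  \prod_(0 <= i < n) (1 - x * q ^+ i).

Definition qpoch_oo (K : numFieldType) (q x : K) : K :=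
  limn (qpoch q x).

(* The coefficient of X^l in X (X - 1) ... (X - j + 1). *)
Definition stirling1 (j l : nat) : int :=
  (\prod_(0 <= i < j) ('X - (i%:R)%:P) : {poly int})`_l.

Definition coefA (K : numFieldType) (j r t : nat) : K :=
  \sum_(t <= l < j.+1)
    (stirling1 j l)%:~R / (j`!)%:R * ('C(l, t))%:R * (1 - r%:R) ^+ (l - t).

Definition U (K : numFieldType) (m i : nat) (q : K) : K :=
  limn (fun N : nat =>
    \sum_(i <= n < N) n%:R ^+ m * q ^+ n * qpoch_oo q (q ^+ n.+1)).

(* Main.v *)
(** With m = n - r, the Stirling sums on the right-hand side collapse:
    [\sum_t A(j,r,t) n^t = binomial (m+1) j], and Vandermonde's identity turns
    the right-hand side into
      [\sum_(m >= 0) binomial (m+k) k * q^(m+r) * (q^(m+r+1))_oo].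
    Expanding [(q^(m+r+1))_oo] by Euler's identity
      [(x)_oo = \sum_n (-1)^n q^binomial(n,2) x^n / (q)_n],
    exchanging the two sums and evaluating
      [\sum_m binomial (m+k) k * z^m = (1-z)^-(k+1)] at [z = q^(n+1)]
    gives the left-hand side, shifted by one in n. Euler's identity follows from
    the functional equation [F x = (1 - x) * F (x * q)] of its right-hand side,
    iterated, since [F] is continuous at 0 with [F 0 = 1]. *)

Require Import Defs.
From mathcomp Require Import all_boot all_order all_algebra.
From mathcomp Require Import all_classical all_reals all_analysis.
From mathcomp Require Import complex ring zify.
Import Order.TTheory GRing.Theory Num.Theory.
Import numFieldNormedType.Exports.
Local Open Scope classical_set_scope.
Local Open Scope ring_scope.

(** * Series over the complex numbers *)

Lemma norm_cvg_le {K : numFieldType} {u : nat -> K} {l C : K} :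
  u @ \oo --> l -> (\forall n \near \oo, `|u n| <= C) -> `|l| <= C.
Proof.
move=> ul uC.
have [N _ NC] := uC.
(* The order of [K] is only partial; [C] is real because it dominates a norm, so the negated
   inequality can be turned into a strict one. *)
have Cr : C \is Num.real.
  by rewrite ger0_real // (le_trans (normr_ge0 _) (NC N _)) /=.
rewrite real_leNgt ?normr_real//; apply/negP => Cl.
have e0 : 0 < `|l| - C by rewrite subr_gt0.
have /cvgrPdist_lt/(_ _ e0) ul' := ul.
have [n [lun unC]] : exists n, `|l - u n| < `|l| - C /\ `|u n| <= C.
  have : \forall n \near \oo, `|l - u n| < `|l| - C /\ `|u n| <= C.
    by near=> n; split; near: n.
  by case=> M _ /(_ M (leqnn _)); exists M.
have := ler_normD (l - u n) (u n); rewrite subrK => h.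
have := le_lt_trans h (ltr_leD lun unC).
by rewrite subrK ltxx.
Unshelve. all: by end_near. Qed.

Lemma cplx_norm_le {R : realType} (z : R[i]) :
  `|z| <= (`|complex.Re z| + `|complex.Im z|)%:C%C.
Proof.
rewrite normc_def lecR -(@ler_pXn2r _ 2)// ?nnegrE ?sqrtr_ge0 ?addr_ge0//.
rewrite sqr_sqrtr ?addr_ge0 ?sqr_ge0// sqrrD !real_normK ?num_real//.
by rewrite lerD2r lerDl mulrn_wge0// mulr_ge0.
Qed.

Lemma cplx_Im_le {R : realType} (z : R[i]) : `|complex.Im z|%:C%C <= `|z|.
Proof.
by rewrite normc_def lecR -sqrtr_sqr ler_sqrt ?addr_ge0 ?sqr_ge0// lerDr sqr_ge0.
Qed.

Lemma is_cvg_series_bounded {R : realType} {u : nat -> R} {C : R} :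
  (forall N, \sum_(0 <= n < N) `|u n| <= C) -> cvgn (series u).
Proof.
move=> uC; apply: normed_cvg; apply: nondecreasing_is_cvgn.
  apply/nondecreasing_seqP => n.
  by rewrite /normed_series_of /series /= big_nat_recr//= lerDl.
by exists C => _ [N _ <-]; exact: uC.
Qed.

(** Real and imaginary parts are dominated by the norm, so both real series converge absolutely, and
    their limits are the components of the complex limit. *)
Lemma cplx_is_cvg_series_bounded {R : realType} {u : nat -> Cplx R} {C : Cplx R} :
  (forall N, \sum_(0 <= n < N) `|u n| <= C) -> cvgn (series u).
Proof.
move=> uC.
have ReD (x y : R[i]) : complex.Re (x + y) = complex.Re x + complex.Re y.
  by case: x y => [? ?] [].
have ImD (x y : R[i]) : complex.Im (x + y) = complex.Im x + complex.Im y.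
  by case: x y => [? ?] [].
pose re n : R := complex.Re (u n : R[i]); pose im n : R := complex.Im (u n : R[i]).
have bnd (f : R[i] -> R) : (forall z, `|f z|%:C%C <= `|z|) ->
    forall N, \sum_(0 <= n < N) `|f (u n)| <= complex.Re (C : R[i]).
  move=> fle N; have := uC N; rewrite lecE => /andP[_].
  apply: le_trans; rewrite (big_morph _ ReD (erefl _)).
  apply: ler_sum => n _.
  by have := fle (u n); rewrite lecE => /andP[].
have /cvg_ex[a reA] := is_cvg_series_bounded (bnd _ (@normc_ge_Re R)).
have /cvg_ex[b imB] := is_cvg_series_bounded (bnd _ (@cplx_Im_le R)).
apply/cvg_ex; exists (Complex a b : Cplx R).
(* In [R[i]], [0 < e] says that [e] has zero imaginary part and positive real part. *)
apply/cvgrPdist_lt => /= e; rewrite ltcE /= => /andP[/eqP ei e0].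
have e20 : 0 < complex.Re (e : R[i]) / 2 by rewrite divr_gt0.
move/cvgrPdist_lt/(_ _ e20) : reA => reA; move/cvgrPdist_lt/(_ _ e20) : imB => imB.
have ReS N : complex.Re (series u N : R[i]) = series re N.
  exact: (big_morph _ ReD (erefl _)).
have ImS N : complex.Im (series u N : R[i]) = series im N.
  exact: (big_morph _ ImD (erefl _)).
have ReB (x y : R[i]) : complex.Re (x - y) = complex.Re x - complex.Re y.
  by case: x y => [? ?] [].
have ImB (x y : R[i]) : complex.Im (x - y) = complex.Im x - complex.Im y.
  by case: x y => [? ?] [].
near=> N.
apply: (le_lt_trans (cplx_norm_le _)).
rewrite ltcE /= ei eqxx /=.
rewrite (ReB (Complex a b)) (ImB (Complex a b)) ReS ImS /=.
rewrite [ltRHS]splitr; apply: ltrD; near: N; [exact: reA|exact: imB].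
Unshelve. all: by end_near. Qed.

Lemma cvg_of_shiftS {K : numFieldType} {u : nat -> K} {l : K} :
  (fun n => u n.+1) @ \oo --> l -> u @ \oo --> l.
Proof. by rewrite -(cvg_shiftS u). Qed.

Lemma cvg_sum_nat {K : numFieldType} {f : nat -> nat -> K} {l : nat -> K} (m n : nat) :
  (forall i, f i @ \oo --> l i) ->
  (fun N => \sum_(m <= i < n) f i N) @ \oo --> \sum_(m <= i < n) l i.
Proof.
move=> fl; apply: cvg_big => [|i _]; [exact: add_continuous|exact: fl].
Qed.

(* The rows converge uniformly in the column index, thanks to the majorant [w]. *)
Lemma cplx_exchange_series {R : realType} {a w h g : nat -> Cplx R}
    {b : nat -> nat -> Cplx R} {A W : Cplx R} :
  (forall N, \sum_(0 <= n < N) `|a n| <= A) ->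
  (forall N, \sum_(0 <= m < N) w m <= W) ->
  (forall m n, `|b m n| <= w m) ->
  (forall m, series (fun n => a n * b m n) @ \oo --> h m) ->
  (forall n, series (fun m => b m n) @ \oo --> g n) ->
  exists l : Cplx R, series (fun n => a n * g n) @ \oo --> l /\ series h @ \oo --> l.
Proof.
move=> aA wW bw ah bg.
have w0 m : 0 <= w m by exact: le_trans (normr_ge0 _) (bw m 0).
have A0 : 0 <= A by have := aA 0; rewrite big_geq.
have gW n : `|g n| <= W.
  apply: (norm_cvg_le (bg n)); near=> N.
  apply: le_trans (wW N); apply: le_trans (ler_norm_sum _ _ _) _.
  by apply: ler_sum => m _; exact: bw.
have /cvg_ex[l agl] : cvgn (series (fun n => a n * g n)).
  apply: (@cplx_is_cvg_series_bounded _ _ (A * W)) => N.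
  apply: (@le_trans _ _ (\sum_(0 <= n < N) `|a n| * W)).
    by apply: ler_sum => n _; rewrite normrM ler_wpM2l.
  rewrite -mulr_suml ler_wpM2r// ?aA//.
  by exact: le_trans (normr_ge0 _) (gW 0).
exists l; split=> //.
have /cvg_ex[W0 wW0] : cvgn (series w).
  apply: (@cplx_is_cvg_series_bounded _ _ W) => N; apply: le_trans (wW N).
  by apply: ler_sum => n _; rewrite ger0_norm.
apply/cvgrPdist_le => e e0.
(* Chosen so that [A * (d + d) <= e]; the [+ 1] covers [A = 0]. *)
pose d := e / (A + 1) / 2.
have d0 : 0 < d by rewrite !divr_gt0// ltr_wpDl.
move/cvgrPdist_le/(_ _ d0) : wW0 => [M0 _ hM0].
exists M0 => // M /= M0M.
have tail n : `|g n - series (fun m => b m n) M| <= d + d.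
  apply: (norm_cvg_le (cvgB (bg n) (cvg_cst _))).
  exists M => // P /= MP.
  rewrite [X in `|X|](_ : _ = series (b^~ n) P - series (b^~ n) M)// sub_series_geq//.
  apply: le_trans (ler_norm_sum _ _ _) _.
  apply: (@le_trans _ _ (series w P - series w M)).
    by rewrite sub_series_geq//; apply: ler_sum => m _; exact: bw.
  apply: le_trans (_ : `|series w P - series w M| <= _).
    by rewrite ger0_norm// sub_series_geq// sumr_ge0.
  apply: le_trans (ler_distD W0 _ _) _.
  by rewrite lerD// ?[`|series w P - _|]distrC; apply: hM0 => //=; exact: leq_trans MP.
(* [l - series h M] is the limit of the sums over [n] of [a n] times the tail of row sums bounded in
   [tail]. *)
have lM := cvgB agl (cvg_sum_nat 0 M ah).
apply: (norm_cvg_le (lM _)); near=> P.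
rewrite [X in `|X|](_ : _ =
    \sum_(0 <= n < P) (a n * g n - a n * series (b^~ n) M)); last first.
  rewrite sumrB; congr (_ - _); rewrite /series /= exchange_big.
  by apply: eq_bigr => n _; rewrite mulr_sumr.
apply: le_trans (ler_norm_sum _ _ _) _.
apply: (@le_trans _ _ (\sum_(0 <= n < P) `|a n| * (d + d))).
  by apply: ler_sum => n _; rewrite -mulrBr normrM ler_wpM2l//; exact: tail.
rewrite -mulr_suml.
apply: (@le_trans _ _ (A * (d + d))); first by rewrite ler_wpM2r// ?aA// addr_ge0// ltW.
rewrite /d -splitr mulrA ler_pdivrMr ?ltr_wpDl//.
by rewrite mulrC ler_wpM2l// ?ltW// ltrDl.
Unshelve. all: by end_near. Qed.

(** * The binomial series *)

Lemma geometric_partial_sum {K : comPzRingType} (z : K) N :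
  (1 - z) * (\sum_(0 <= m < N) z ^+ m) = 1 - z ^+ N.
Proof.
elim: N => [|N IH]; first by rewrite big_geq// mulr0 expr0 subrr.
by rewrite big_nat_recr//= mulrDr IH exprS; ring.
Qed.

(** Pascal's rule: the factor [1 - z] lowers the order from [k.+1] to [k], leaving one boundary
    term. The inductions on [k] below rest on it. *)
Lemma binomial_partial_sumS {K : comPzRingType} (z : K) k N :
  (1 - z) * (\sum_(0 <= m < N) 'C(m + k.+1, k.+1)%:R * z ^+ m) =
  \sum_(0 <= m < N) 'C(m + k, k)%:R * z ^+ m - 'C(N + k, k.+1)%:R * z ^+ N.
Proof.
elim: N => [|N IH]; first by rewrite !big_geq// mulr0 bin_small// mul0r subrr.
rewrite !big_nat_recr//= mulrDr IH addSn addnS binS natrD exprS.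
ring.
Qed.

Lemma binomial_partial_sum_le {K : numFieldType} (x : K) k N :
  0 <= x -> x < 1 ->
  \sum_(0 <= m < N) 'C(m + k, k)%:R * x ^+ m <= (1 - x) ^- k.+1.
Proof.
move=> x0 x1; have x1' : 0 < 1 - x by rewrite subr_gt0.
elim: k N => [|k IH] N; rewrite -[leRHS]mul1r.
  rewrite ler_pdivlMr ?exprn_gt0// mulrC.
  under eq_bigr do rewrite bin0 mul1r.
  by rewrite geometric_partial_sum gerBl exprn_ge0.
rewrite exprS invfM mulrA mulrAC mul1r ler_pdivlMr// mulrC binomial_partial_sumS.
by apply: le_trans (IH N); rewrite gerBl mulr_ge0// exprn_ge0.
Qed.

Lemma binomial_norm_sum_le {K : numFieldType} (z : K) k N :
  `|z| < 1 ->
  \sum_(0 <= m < N) `|'C(m + k, k)%:R * z ^+ m| <= (1 - `|z|) ^- k.+1.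
Proof.
move=> z1; under eq_bigr do rewrite normrM normr_nat normrX.
exact: binomial_partial_sum_le.
Qed.

Lemma cvg_scale_sub {K : numFieldType} (c : K) {f g : nat -> K} {a b : K} :
  f @ \oo --> a -> g @ \oo --> b -> (fun n => c * (f n - g n)) @ \oo --> c * (a - b).
Proof. by move=> fa gb; exact: (cvgMl_tmp (cvgB fa gb)). Qed.

Lemma cvg_mul_right0 {K : numFieldType} (c : K) {f : nat -> K} :
  f @ \oo --> (0 : K) -> (fun n => f n * c) @ \oo --> (0 : K).
Proof.
move=> f0; suff : (fun n => f n * c) @ \oo --> 0 * c by rewrite mul0r.
exact: (cvgMr_tmp f0).
Qed.

(** Induction on [k], dividing by [1 - z] at each step. Every order contributes its own boundary
    term, hence the hypothesis for all [j]. *)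
Lemma cvg_binomial_series_terms {K : numFieldType} (z : K) k :
  z != 1 -> (forall j, (fun m => 'C(m + j, j)%:R * z ^+ m) @ \oo --> (0 : K)) ->
  series (fun m => 'C(m + k, k)%:R * z ^+ m) @ \oo --> (1 - z) ^- k.+1.
Proof.
move=> z1 terms0.
have nz : 1 - z != 0 by rewrite subr_eq0 eq_sym.
elim: k => [|k IH].
  have -> : (1 - z) ^- 1 = (1 - z)^-1 * (1 - 0) by rewrite subr0 mulr1.
  rewrite (_ : series _ = fun N => (1 - z)^-1 * (1 - 'C(N + 0, 0)%:R * z ^+ N)).
    apply: (@cvg_scale_sub _ _ (fun=> 1)); [exact: cvg_cst|exact: (terms0 0)].
  apply/funext => N; rewrite addn0 bin0 mul1r -geometric_partial_sum mulKf//.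
  by rewrite /series /=; apply: eq_bigr => m _; rewrite bin0 mul1r.
rewrite (_ : series _ = fun N => (1 - z)^-1 *
    (series (fun m => 'C(m + k, k)%:R * z ^+ m) N - 'C(N + k, k.+1)%:R * z ^+ N)).
  have -> : (1 - z) ^- k.+2 = (1 - z)^-1 * ((1 - z) ^- k.+1 - 0).
    by rewrite subr0 exprS invfM.
  apply: (cvg_scale_sub _ IH).
  (* Shifted by one, the boundary term is [z] times a term of order [k.+1]. *)
  rewrite -cvg_shiftS.
  rewrite [X in X @ _](_ : _ = fun n => 'C(n + k.+1, k.+1)%:R * z ^+ n * z); last first.
    by apply/funext => n /=; rewrite addSnnS exprSr mulrA.
  exact: cvg_mul_right0.
by apply/funext => N; rewrite -binomial_partial_sumS mulKf.
Qed.

(** The bound on the partial sums of norms already gives convergence of the series, which forces its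
    terms to 0 without any growth estimate. *)
Lemma cvg_binomial_terms {R : realType} (z : Cplx R) k :
  `|z| < 1 -> (fun m => 'C(m + k, k)%:R * z ^+ m) @ \oo --> (0 : Cplx R).
Proof.
move=> z1; apply: cvg_series_cvg_0; apply: cplx_is_cvg_series_bounded => N.
exact: binomial_norm_sum_le.
Qed.

Lemma cvg_binomial_series {R : realType} (z : Cplx R) k :
  `|z| < 1 ->
  series (fun m => 'C(m + k, k)%:R * z ^+ m) @ \oo --> (1 - z) ^- k.+1.
Proof.
move=> z1; apply: cvg_binomial_series_terms => [|j].
  by apply: contraTneq z1 => ->; rewrite normr1 ltxx.
exact: cvg_binomial_terms.
Qed.

Lemma cplx_cvg_expr {R : realType} (z : Cplx R) :
  `|z| < 1 -> (fun n => z ^+ n) @ \oo --> (0 : Cplx R).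
Proof.
move=> z1; rewrite [X in X @ _](_ : _ = fun m => 'C(m + 0, 0)%:R * z ^+ m).
  exact: cvg_binomial_terms.
by apply/funext => n; rewrite bin0 mul1r.
Qed.

(** * Euler's identity *)

Lemma sum_le_of_ratio {K : numFieldType} {u : nat -> K} n0 :
  (forall n, 0 <= u n) -> (forall n, (n0 <= n)%N -> u n.+1 *+ 2 <= u n) ->
  exists A, forall N, \sum_(0 <= n < N) u n <= A.
Proof.
move=> u0 ratio; exists (\sum_(0 <= n < n0) u n + u n0 *+ 2) => N.
(* Beyond [n0], the partial sum plus twice the next term is nonincreasing. *)
have mono m : \sum_(0 <= n < n0 + m) u n + u (n0 + m)%N *+ 2 <=
    \sum_(0 <= n < n0) u n + u n0 *+ 2.
  elim: m => [|m IH]; first by rewrite addn0.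
  apply: le_trans IH; rewrite addnS big_nat_recr//= -addrA lerD2l mulr2n lerD2l.
  by apply: ratio; rewrite leq_addr.
apply: le_trans (mono N).
rewrite [leRHS](_ : _ = \sum_(0 <= n < N) u n +
    (\sum_(N <= n < n0 + N) u n + u (n0 + N)%N *+ 2)).
  by rewrite lerDl addr_ge0 ?mulrn_wge0// sumr_ge0.
by rewrite [RHS]addrA -big_cat_nat ?leq_addl.
Qed.

(** The coefficient of [x^n] in Euler's expansion of [(x)_oo]. *)
Definition euler_coef {K : numFieldType} (q : K) (n : nat) : K :=
  (-1) ^+ n * q ^+ 'C(n, 2) / qpoch q q n.

Lemma one_sub_exp_neq0 {K : numFieldType} (q : K) n : `|q| < 1 -> 1 - q ^+ n.+1 != 0.
Proof.
move=> q1; rewrite subr_eq0; apply/eqP => e.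
have : `|q ^+ n.+1| < 1 by rewrite normrX exprn_ilt1.
by rewrite -e normr1 ltxx.
Qed.

Lemma qpochS {K : numFieldType} (q x : K) n :
  qpoch q x n.+1 = qpoch q x n * (1 - x * q ^+ n).
Proof. by rewrite /qpoch big_nat_recr. Qed.

Lemma qpoch0 {K : numFieldType} (q x : K) : qpoch q x 0 = 1.
Proof. by rewrite /qpoch big_geq. Qed.

Lemma qpoch_neq0 {K : numFieldType} (q : K) n : `|q| < 1 -> qpoch q q n != 0.
Proof.
move=> q1; elim: n => [|n IH]; first by rewrite qpoch0 oner_neq0.
by rewrite qpochS mulf_neq0// -exprS one_sub_exp_neq0.
Qed.

Lemma euler_coef0 {K : numFieldType} (q : K) : euler_coef q 0 = 1.
Proof. by rewrite /euler_coef qpoch0 bin0n divr1 !expr0 mulr1. Qed.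

(** This is [F x - F (x * q) = - x * F (x * q)] read coefficientwise. *)
Lemma euler_coefS {K : numFieldType} (q : K) n : `|q| < 1 ->
  euler_coef q n.+1 * (1 - q ^+ n.+1) = - q ^+ n * euler_coef q n.
Proof.
move=> q1; have nz := one_sub_exp_neq0 q n q1; have pz := qpoch_neq0 q n q1.
rewrite /euler_coef qpochS -exprS binS bin1 exprD exprS.
by field; rewrite pz nz.
Qed.

(** The functional equation for truncated series; the last sum is one term shorter because the
    factor [x] raises degrees by one. *)
Lemma euler_coef_partial_sum {K : numFieldType} (q x : K) N : `|q| < 1 ->
  \sum_(0 <= n < N.+1) euler_coef q n * x ^+ n =
  \sum_(0 <= n < N.+1) euler_coef q n * (x * q) ^+ n -
  x * \sum_(0 <= n < N) euler_coef q n * (x * q) ^+ n.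
Proof.
move=> q1; rewrite !big_nat_recl// !expr0 -addrA; congr (_ + _).
rewrite mulr_sumr -sumrB; apply: eq_bigr => n _.
rewrite (_ : euler_coef q n.+1 * x ^+ n.+1 =
  euler_coef q n.+1 * (1 - q ^+ n.+1) * x ^+ n.+1 +
  euler_coef q n.+1 * (x * q) ^+ n.+1); last by rewrite exprMn; ring.
by rewrite euler_coefS// !exprMn !exprS; ring.
Qed.

(** The ratio of consecutive coefficients has norm [|q^n| / |1 - q^(n+1)|], and the denominator is
    at least [1 - |q|]. *)
Lemma euler_coef_ratio {K : numFieldType} (q : K) n : `|q| < 1 ->
  `|q ^+ n| <= (1 - `|q|) / 2 -> `|euler_coef q n.+1| *+ 2 <= `|euler_coef q n|.
Proof.
move=> q1 qn; have d0 : 0 < 1 - `|q| by rewrite subr_gt0.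
have dle : 1 - `|q| <= `|1 - q ^+ n.+1|.
  apply: le_trans (lerB_dist _ _); rewrite normr1 lerD2l lerN2 normrX exprS.
  by rewrite ler_piMr// exprn_ile1// ltW.
rewrite -(ler_pM2l d0).
apply: (@le_trans _ _ (`|euler_coef q n.+1 * (1 - q ^+ n.+1)| *+ 2)).
  by rewrite (normrM (euler_coef q n.+1)) mulrnAr lerMn2r/= mulrC ler_wpM2l.
rewrite euler_coefS// (normrM (- q ^+ n)) normrN -mulrnAl ler_wpM2r//.
by rewrite -mulr_natr -ler_pdivlMr.
Qed.

Lemma cplx_euler_coef_summable {R : realType} (q : Cplx R) : `|q| < 1 ->
  exists A, forall N, \sum_(0 <= n < N) `|euler_coef q n| <= A.
Proof.
move=> q1.
have e0 : 0 < (1 - `|q|) / 2 by rewrite divr_gt0 ?subr_gt0.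
have /cvgrPdist_le/(_ _ e0)[n0 _ small] := cplx_cvg_expr q q1.
apply: (sum_le_of_ratio n0) => // n n0n.
apply: euler_coef_ratio => //.
by have := small n n0n; rewrite sub0r normrN.
Qed.

(** Eventually [f n] is nonzero, being within distance 1 of 1, and then [p n = c / f n]. *)
Lemma cvg_of_mul_eq {K : numFieldType} {p f : nat -> K} {c : K} :
  (forall n, p n * f n = c) -> f @ \oo --> (1 : K) -> p @ \oo --> c.
Proof.
move=> pf f1.
have : (fun n => c * (f n)^-1) @ \oo --> c * 1^-1.
  exact: (cvgMl_tmp (cvgV (oner_neq0 K) f1)).
rewrite invr1 mulr1; apply: cvg_trans; apply: near_eq_cvg.
have /cvgrPdist_lt/(_ _ ltr01)[N _ hN] := f1.
exists N => // n /= Nn; rewrite -(pf n) mulfK//.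
by apply: contraTneq (hN n Nn) => ->; rewrite subr0 normr1 ltxx.
Qed.

Lemma cvg_qpoch {K : numFieldType} (q x A : K) (F : K -> K) :
  `|q| < 1 -> (fun n => q ^+ n) @ \oo --> (0 : K) ->
  (forall N, \sum_(0 <= n < N) `|euler_coef q n| <= A) ->
  (forall y, `|y| <= 1 -> series (fun n => euler_coef q n * y ^+ n) @ \oo --> F y) ->
  `|x| <= 1 -> qpoch q x @ \oo --> F x.
Proof.
move=> q1 qto0 cA cvF x1.
(* The limit of the truncated functional equation; the closed unit disc is stable under
   multiplication by [q]. *)
have step y : `|y| <= 1 -> F y = (1 - y) * F (y * q).
  move=> y1; have yq1 : `|y * q| <= 1 by rewrite normrM mulr_ile1// ltW.
  pose S z := series (fun n => euler_coef q n * z ^+ n).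
  have l1 : (fun N => S y N.+1) @ \oo --> F y.
    by have := cvF _ y1; rewrite -cvg_shiftS.
  have l2 : (fun N => S (y * q) N.+1) @ \oo --> F (y * q).
    by have := cvF _ yq1; rewrite -cvg_shiftS.
  have l3 : (fun N => S (y * q) N.+1 - y * S (y * q) N) @ \oo -->
      F (y * q) - y * F (y * q).
    exact: (cvgB l2 (cvgMl_tmp (cvF _ yq1))).
  have e : (fun N => S (y * q) N.+1 - y * S (y * q) N) = (fun N => S y N.+1).
    by apply/funext => N; rewrite /S /series /= (euler_coef_partial_sum q y).
  rewrite e in l3.
  by rewrite mulrBl mul1r; exact: (cvg_unique _ l1 l3).
have xq N : `|x * q ^+ N| <= 1 by rewrite normrM mulr_ile1// normrX exprn_ile1// ltW.
(* Iterating [step] keeps [qpoch q x N * F (x * q ^+ N)] equal to [F x]. *)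
apply: (@cvg_of_mul_eq _ _ (fun N => F (x * q ^+ N))) => [N|].
  elim: N => [|N <-]; first by rewrite qpoch0 expr0 mulr1 mul1r.
  by rewrite qpochS -mulrA (step (x * q ^+ N))// exprSr !mulrA.
(* Quantitative continuity at 0: every term but the constant one, which is 1, carries a factor
   [y]. *)
have Fle y : `|y| <= 1 -> `|F y - 1| <= A * `|y|.
  move=> y1; apply: (norm_cvg_le (cvgB (cvF y y1) (cvg_cst (1 : K)))).
  exists 1%N => // -[//|N] _.
  rewrite [X in `|X|](_ : _ = \sum_(0 <= n < N) euler_coef q n.+1 * y ^+ n.+1).
    apply: le_trans (ler_norm_sum _ _ _) _.
    apply: (@le_trans _ _ ((\sum_(0 <= n < N.+1) `|euler_coef q n|) * `|y|)).
      rewrite big_nat_recl// mulrDl mulr_suml.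
      rewrite -[leLHS]add0r lerD ?mulr_ge0//.
      apply: ler_sum => n _; rewrite normrM ler_wpM2l// exprS normrM.
      by rewrite ler_piMr// normrX exprn_ile1.
    by rewrite ler_wpM2r.
  rewrite -[RHS](addrK 1); congr (_ - _).
  by rewrite /series /= big_nat_recl// euler_coef0 expr0 mulr1 addrC.
have A0 : 0 <= A by have := cA 0; rewrite big_geq.
apply/cvgrPdist_le => e e0.
have d0 : 0 < e / (A + 1) by rewrite divr_gt0// ltr_wpDl.
have /cvgrPdist_le/(_ _ d0) [N _ hN] := qto0.
exists N => // n /= Nn; rewrite distrC.
apply: le_trans (Fle _ (xq n)) _.
have := hN n Nn; rewrite sub0r normrN => qn.
apply: (@le_trans _ _ (A * (e / (A + 1)))).
  by rewrite ler_wpM2l// normrM (le_trans _ qn)// ler_piMl.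
rewrite mulrA ler_pdivrMr ?ltr_wpDl//.
by rewrite mulrC ler_wpM2l// ?ltW// ltrDl.
Qed.

(** The bound [A] is independent of [x]: below it bounds [qpoch_oo] on the unit disc and dominates
    the exchange of sums. *)
Lemma cplx_euler {R : realType} (q : Cplx R) : `|q| < 1 ->
  exists A : Cplx R, (forall N, \sum_(0 <= n < N) `|euler_coef q n| <= A) /\
  forall x : Cplx R, `|x| <= 1 ->
    series (fun n => euler_coef q n * x ^+ n) @ \oo --> qpoch_oo q x.
Proof.
move=> q1; have [A cA] := cplx_euler_coef_summable q q1; exists A; split=> // x x1.
have cvF y : `|y| <= 1 -> cvgn (series (fun n => euler_coef q n * y ^+ n)).
  move=> y1; apply: (@cplx_is_cvg_series_bounded _ _ A) => N.
  apply: le_trans (cA N); apply: ler_sum => n _.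
  by rewrite normrM ler_piMr// normrX exprn_ile1.
have := cvg_qpoch q x A _ q1 (cplx_cvg_expr q q1) cA cvF x1.
by move=> /cvg_lim => /(_ (@norm_hausdorff _ _)); rewrite /qpoch_oo => ->; exact: cvF.
Qed.

(** * Stirling numbers and binomial sums *)

Lemma horner_falling_factorial (j m : nat) :
  (\prod_(0 <= i < j) ('X - (i%:R)%:P) : {poly int}).[m%:R] = (m ^_ j)%:R.
Proof.
elim: j => [|j IH]; first by rewrite big_geq// hornerC.
rewrite big_nat_recr//= hornerM IH hornerXsubC ffactnSr natrM.
(* For [m < j] the natural subtraction truncates, but [m ^_ j] is already 0. *)
have [jm|mj] := leqP j m; first by rewrite natrB.
by rewrite ffact_small// !mul0r.
Qed.

Lemma sum_stirling1_exp {K : numFieldType} (j m : nat) :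
  \sum_(0 <= l < j.+1) (stirling1 j l)%:~R * m%:R ^+ l = (m ^_ j)%:R :> K.
Proof.
have sz : (size (\prod_(0 <= i < j) ('X - (i%:R)%:P) : {poly int})%R <= j.+1)%N.
  by rewrite size_prod_XsubC size_iota subn0.
have := horner_falling_factorial j m; rewrite (horner_coef_wide _ sz).
move/(congr1 (fun z : int => z%:~R : K)); rewrite rmorph_sum /= mulrz_nat => <-.
by rewrite big_mkord; apply: eq_bigr => l _; rewrite rmorphM rmorphXn /= mulrz_nat.
Qed.

(** After exchanging the sums, the sum over [t] is the binomial expansion of [(n + 1 - r)^l], and
    the Stirling numbers assemble these powers into a falling factorial. The hypothesis makes
    [n.+1 - r] a true difference. *)
Lemma coefA_sum {K : numFieldType} (j r n : nat) : (r <= n.+1)%N ->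
  \sum_(0 <= t < j.+1) coefA K j r t * n%:R ^+ t = 'C(n.+1 - r, j)%:R.
Proof.
move=> rn; have jf : (j`!)%:R != 0 :> K by rewrite pnatr_eq0 -lt0n fact_gt0.
apply: (mulIf jf); rewrite -natrM bin_ffact -sum_stirling1_exp mulr_suml.
(* The range [t <= l] is extended to all [l], since ['C(l, t)] vanishes for [l < t]. *)
rewrite [LHS](_ : _ = \sum_(0 <= t < j.+1) \sum_(0 <= l < j.+1)
    (stirling1 j l)%:~R * ('C(l, t)%:R * (1 - r%:R) ^+ (l - t) * n%:R ^+ t)).
  rewrite exchange_big /=; apply: eq_big_nat => l /andP[_ lj].
  rewrite -mulr_sumr; congr (_ * _).
  rewrite (@big_cat_nat _ _ _ l.+1)//= [Y in _ + Y = _](_ : _ = 0) ?addr0.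
    rewrite natrB// -[n.+1]add1n natrD addrAC exprDn big_mkord.
    by apply: eq_bigr => t _; rewrite -[RHS]mulr_natl mulrA.
  rewrite big_nat_cond big1// => t /andP[/andP[lt _] _].
  by rewrite bin_small// !mul0r.
apply: eq_big_nat => t /andP[_ tj].
rewrite [RHS](big_cat_nat (n := t))//=; last exact: ltnW.
rewrite [Y in _ = Y + _](_ : _ = 0) ?add0r.
  by rewrite /coefA !mulr_suml; apply: eq_bigr => l _; field.
rewrite big_nat_cond big1// => l /andP[/andP[_ lt] _].
by rewrite bin_small// !mul0r mulr0.
Qed.

(** Vandermonde's convolution with ['C(k, j - 1) = 'C(k, k.+1 - j)]; its term at [j = 0] is zero. *)
Lemma sum_bin_pred_bin (k m : nat) :
  (\sum_(1 <= j < k.+2) 'C(k, j - 1) * 'C(m.+1, j) = 'C(m + k.+1, k.+1))%N.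
Proof.
rewrite -addSnnS -binomial.Vandermonde.
rewrite -(big_mkord xpredT (fun j => 'C(m.+1, j) * 'C(k, k.+1 - j))%N).
rewrite [RHS]big_nat_recl// subn0 [in 'C(k, k.+1)]bin_small// muln0 add0n big_add1 /=.
apply: eq_big_nat => j /andP[_ jk]; by rewrite subn1 /= subSS mulnC bin_sub//.
Qed.

(** With [j + t] as new index, both sides run over the triangle [1 <= t <= j <= k]. *)
Lemma exchange_triangular_sum {K : nmodType} (k : nat) (G : nat -> nat -> K) :
  \sum_(1 <= t < k.+1) \sum_(0 <= j < (k - t).+1) G (j + t)%N t =
  \sum_(1 <= j < k.+1) \sum_(1 <= t < j.+1) G j t.
Proof.
transitivity (\sum_(1 <= t < k.+1) \sum_(1 <= j < k.+1)
    if (t <= j)%N then G j t else 0).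
  apply: eq_big_nat => t /andP[t1 tk].
  transitivity (\sum_(0 + t <= j < k.+1) G j t); first by rewrite big_addn subSn.
  by rewrite add0n (big_nat_widenl _ 1)// big_mkcond.
rewrite exchange_big /=; apply: eq_big_nat => j /andP[j1 jk].
by rewrite [RHS](big_nat_widen _ _ k.+1)// [RHS]big_mkcond.
Qed.

(** The separate sum with [t = 0] in the theorem is the missing column of the triangle. *)
Lemma triangular_sum_split {K : nmodType} (k : nat) (G : nat -> nat -> K) :
  \sum_(1 <= t < k.+1) \sum_(0 <= j < (k - t).+1) G (j + t)%N t +
    \sum_(1 <= j < k.+1) G j 0 =
  \sum_(1 <= j < k.+1) \sum_(0 <= t < j.+1) G j t.
Proof.
rewrite exchange_triangular_sum -big_split /=.
by apply: eq_bigr => j _; rewrite [LHS]addrC [RHS]big_ltn.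
Qed.

(** * Both sides as limits *)

(** The right-hand side is a product of [m] factors, each at least [n]. It lets the binomial series
    dominate the series of [U]. *)
Lemma expn_le_fact_mul_bin (n m : nat) : (n ^ m <= 'C(n + m, m) * m`!)%N.
Proof.
rewrite bin_ffact; elim: m => [|m IH]; first by rewrite ffactn0.
by rewrite addnS ffactSS expnS leq_mul// ltnW// ltnS leq_addr.
Qed.

(** [U] is a [limn], meaningful only once convergence is known. *)
Lemma cplx_cvg_U {R : realType} (q : Cplx R) (m i : nat) : `|q| < 1 ->
  (fun N => \sum_(i <= n < N) n%:R ^+ m * q ^+ n * qpoch_oo q (q ^+ n.+1))
    @ \oo --> U m i q.
Proof.
move=> q1; have [A [cA euler]] := cplx_euler q q1.
have A0 : 0 <= A by have := cA 0; rewrite big_geq.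
have leA x : `|x| <= 1 -> `|qpoch_oo q x| <= A.
  move=> x1; apply: (norm_cvg_le (euler x x1)); exists 0 => // N _.
  apply: le_trans (cA N); apply: le_trans (ler_norm_sum _ _ _) _.
  by apply: ler_sum => n _; rewrite normrM ler_piMr// normrX exprn_ile1.
have : cvgn (series (fun n => n%:R ^+ m * q ^+ n * qpoch_oo q (q ^+ n.+1) : Cplx R)).
  apply: (@cplx_is_cvg_series_bounded _ _ ((1 - `|q|) ^- m.+1 * (m`!%:R * A))) => N.
  apply: (@le_trans _ _
      ((\sum_(0 <= n < N) `|'C(n + m, m)%:R * q ^+ n|) * (m`!%:R * A))).
    rewrite mulr_suml; apply: ler_sum => n _.
    rewrite normrM mulrA ler_pM// ?leA//; last first.
      by rewrite normrX exprn_ile1// ltW.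
    rewrite !normrM mulrAC ler_wpM2r// -natrX !normr_nat -natrM ler_nat.
    exact: expn_le_fact_mul_bin.
  by rewrite ler_wpM2r ?mulr_ge0// binomial_norm_sum_le.
by rewrite -(is_cvg_series_restrict i).
Qed.

(** An exact finite identity: truncating at [N + r] makes [n = m + r] range over all [m < N],
    whatever [j] is. *)
Lemma double_sum_coefA {K : numFieldType} (k r N : nat) (v : nat -> K) :
  \sum_(1 <= j < k.+2) \sum_(0 <= t < j.+1)
    'C(k.+1 - 1, j - 1)%:R * coefA K j r t *
      \sum_((r + j - 1)%N <= n < N + r) n%:R ^+ t * v n =
  \sum_(0 <= m < N) 'C(m + k.+1, k.+1)%:R * v (m + r)%N.
Proof.
transitivity (\sum_(1 <= j < k.+2) \sum_(0 <= m < N)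
    ('C(k, j - 1) * 'C(m.+1, j))%:R * v (m + r)%N).
  apply: eq_big_nat => j /andP[j1 _].
  transitivity (\sum_((r + j - 1)%N <= n < N + r)
      ('C(k, j - 1) * 'C(n.+1 - r, j))%:R * v n).
    under eq_bigr do rewrite mulr_sumr.
    rewrite exchange_big /=; apply: eq_big_nat => n /andP[rn _].
    rewrite natrM -(@coefA_sum _ j r n); last by lia.
    rewrite mulr_sumr mulr_suml; apply: eq_bigr => t _.
    by rewrite subn1 /=; ring.
  (* All ranges are made to start at [r]; the added terms have [m.+1 < j], so ['C(m.+1, j)] is 0. *)
  rewrite (big_nat_widenl _ r)//; last by lia.
  rewrite big_mkcond /= -{1}[r]add0n big_addn addnK.
  apply: eq_bigr => m _; rewrite -addSn addnK.
  case: ifP => // /negbT; rewrite -ltnNge => mj.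
  by rewrite (@bin_small m.+1) ?muln0 ?mul0r//; lia.
rewrite exchange_big /=; apply: eq_bigr => m _.
by rewrite -mulr_suml -natr_sum sum_bin_pred_bin.
Qed.

Lemma cvg_double_sum_U {R : realType} (q : Cplx R) (r k : nat) : `|q| < 1 ->
  series (fun m => 'C(m + k.+1, k.+1)%:R *
      (q ^+ (m + r) * qpoch_oo q (q ^+ (m + r).+1))) @ \oo -->
  \sum_(1 <= j < k.+2) \sum_(0 <= t < j.+1)
    'C(k.+1 - 1, j - 1)%:R * coefA (Cplx R) j r t * U t (r + j - 1) q.
Proof.
move=> q1; pose v n := q ^+ n * qpoch_oo q (q ^+ n.+1).
have lim : (fun N => \sum_(1 <= j < k.+2) \sum_(0 <= t < j.+1)
    'C(k.+1 - 1, j - 1)%:R * coefA (Cplx R) j r t *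
      \sum_((r + j - 1)%N <= n < N) n%:R ^+ t * v n) @ \oo -->
    \sum_(1 <= j < k.+2) \sum_(0 <= t < j.+1)
      'C(k.+1 - 1, j - 1)%:R * coefA (Cplx R) j r t * U t (r + j - 1) q.
  apply: cvg_sum_nat => j; apply: cvg_sum_nat => t.
  have Ut := cplx_cvg_U q t (r + j - 1) q1.
  have e : (fun N => \sum_((r + j - 1)%N <= n < N) n%:R ^+ t * v n) =
      (fun N => \sum_((r + j - 1)%N <= n < N)
        n%:R ^+ t * q ^+ n * qpoch_oo q (q ^+ n.+1)).
    by apply/funext => N; apply: eq_bigr => n _; rewrite mulrA.
  rewrite -e in Ut.
  exact: (cvgMl_tmp Ut).
rewrite -(cvg_shiftn r) in lim.
have e : (fun N => \sum_(1 <= j < k.+2) \sum_(0 <= t < j.+1)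
    'C(k.+1 - 1, j - 1)%:R * coefA (Cplx R) j r t *
      \sum_((r + j - 1)%N <= n < N + r) n%:R ^+ t * v n) =
    series (fun m => 'C(m + k.+1, k.+1)%:R * v (m + r)%N).
  by apply/funext => N; rewrite double_sum_coefA.
by rewrite e in lim.
Qed.

Lemma cvg_lambert_series {R : realType} (q : Cplx R) (r k : nat) : `|q| < 1 ->
  exists l : Cplx R,
  series (fun n => (-1) ^+ n * q ^+ ('C(n.+1, 2) + n.+1 * r)
        / ((1 - q ^+ n.+1) ^+ k * qpoch q q n.+1)) @ \oo --> l /\
  series (fun m => 'C(m + k, k)%:R *
      (q ^+ (m + r) * qpoch_oo q (q ^+ (m + r).+1))) @ \oo --> l.
Proof.
move=> q1; have [A [cA euler]] := cplx_euler q q1.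
have qX_le n : `|q ^+ n| <= 1 by rewrite normrX exprn_ile1// ltW.
(* In the double series [a n * b m n], the sum over [n] is Euler's series at [q^(m+r+1)] and the sum
   over [m] is the binomial series at [q^(n+1)]. *)
pose a n := euler_coef q n * q ^+ (n * r.+1 + r).
pose b m n : Cplx R := 'C(m + k, k)%:R * (q ^+ n.+1) ^+ m.
pose w m : Cplx R := 'C(m + k, k)%:R * `|q| ^+ m.
have aA N : \sum_(0 <= n < N) `|a n| <= A.
  apply: le_trans (cA N); apply: ler_sum => n _.
  by rewrite /a (normrM (euler_coef q n)) ler_piMr.
have wW N : \sum_(0 <= m < N) w m <= (1 - `|q|) ^- k.+1.
  exact: binomial_partial_sum_le.
have bw m n : `|b m n| <= w m.
  rewrite /b /w normrM normr_nat ler_wpM2l// normrX lerXn2r ?nnegrE//.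
  by rewrite exprS normrM ler_piMr.
have ah m : series (fun n => a n * b m n) @ \oo -->
    'C(m + k, k)%:R * (q ^+ (m + r) * qpoch_oo q (q ^+ (m + r).+1)).
  have lim : (fun N => 'C(m + k, k)%:R * q ^+ (m + r) *
        series (fun n => euler_coef q n * (q ^+ (m + r).+1) ^+ n) N) @ \oo -->
      'C(m + k, k)%:R * q ^+ (m + r) * qpoch_oo q (q ^+ (m + r).+1).
    exact: (cvgMl_tmp (euler _ (qX_le (m + r).+1))).
  rewrite mulrA [X in X @ _](_ : _ = fun N => 'C(m + k, k)%:R * q ^+ (m + r) *
    series (fun n => euler_coef q n * (q ^+ (m + r).+1) ^+ n) N)//.
  apply/funext => N; apply: esym.
  rewrite /series /= mulr_sumr; apply: eq_bigr => n _.
  rewrite /a /b -!exprM [RHS](_ : _ = euler_coef q n * 'C(m + k, k)%:R *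
    (q ^+ (n * r.+1 + r) * q ^+ (n.+1 * m))); last by ring.
  rewrite [LHS](_ : _ = euler_coef q n * 'C(m + k, k)%:R *
    (q ^+ (m + r) * q ^+ ((m + r).+1 * n))); last by ring.
  by rewrite -!exprD; congr (_ * q ^+ _); lia.
have bg n : series (fun m => b m n) @ \oo --> (1 - q ^+ n.+1) ^- k.+1.
  by apply: cvg_binomial_series; rewrite normrX exprn_ilt1.
have [l [al hl]] := cplx_exchange_series aA wW bw ah bg.
exists l; split=> //.
rewrite [X in series X](_ : _ = fun n => a n * (1 - q ^+ n.+1) ^- k.+1)//.
apply/funext => n.
have nz := one_sub_exp_neq0 q n q1; have pz := qpoch_neq0 q n q1.
have -> : ('C(n.+1, 2) + n.+1 * r = 'C(n, 2) + (n * r.+1 + r))%N.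
  by rewrite binS bin1; lia.
(* One of the [k.+1] factors [1 - q^(n+1)] completes [(q)_n] to [(q)_(n+1)]. *)
rewrite /a /euler_coef qpochS -exprS exprD [(1 - q ^+ n.+1) ^+ k.+1]exprSr.
by field; rewrite pz nz expf_neq0.
Qed.

Theorem theorem2p6 (R : realType) (q : Cplx R) (r k : nat)
    (hq : `|q| < 1) (hk : (1 <= k)%N) :
  (fun N : nat => \sum_(1 <= n < N)
      (-1) ^+ (n - 1) * q ^+ ('C(n, 2) + n * r)
        / ((1 - q ^+ n) ^+ k * qpoch q q n))
    @ \oo -->
  \sum_(1 <= t < k.+1) \sum_(0 <= j < (k - t).+1)
      ('C(k - 1, j + t - 1))%:R * coefA (Cplx R) (j + t) r t * U t (r + j + t - 1) q
  + \sum_(1 <= j < k.+1)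
      ('C(k - 1, j - 1))%:R * coefA (Cplx R) j r 0 * U 0 (r + j - 1) q.
Proof.
case: k hk => // k _.
have [l [lhs rhs]] := cvg_lambert_series q r k.+1 hq.
pose u n : Cplx R := (-1) ^+ (n - 1) * q ^+ ('C(n, 2) + n * r)
  / ((1 - q ^+ n) ^+ k.+1 * qpoch q q n).
have lhs_u : (fun N => \sum_(1 <= n < N) u n) @ \oo --> l.
  apply: cvg_of_shiftS.
  rewrite [X in X @ _](_ : _ = series (fun n =>
    (-1) ^+ n * q ^+ ('C(n.+1, 2) + n.+1 * r)
    / ((1 - q ^+ n.+1) ^+ k.+1 * qpoch q q n.+1)))//.
  apply/funext => N /=; rewrite big_add1; apply: eq_bigr => n _.
  by rewrite /u subn1.
pose G j t := 'C(k.+1 - 1, j - 1)%:R * coefA (Cplx R) j r t * U t (r + j - 1) q.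
(* Both expressions are limits of the same binomial-weighted series, hence equal. *)
have l_eq : l = \sum_(1 <= t < k.+2) \sum_(0 <= j < (k.+1 - t).+1) G (j + t)%N t
    + \sum_(1 <= j < k.+2) G j 0.
  rewrite triangular_sum_split.
  exact: (cvg_unique _ rhs (cvg_double_sum_U q r k hq)).
rewrite l_eq in lhs_u.
rewrite (eq_bigr (fun t => \sum_(0 <= j < (k.+1 - t).+1) G (j + t)%N t))//.
by move=> t _; apply: eq_bigr => j _; rewrite /G addnA.
Qed.
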